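(* Let $G$ be a non-trivial finite $p$-group and let $k$ be a field of characteristic $p$. Every ghost in the stable module category $\mathrm{StMod}(kG)$ is trivial (equivalently: every $kG$-module homomorphism $f\colon M\to N$ inducing the zero map $\underline{\mathrm{Hom}}_{kG}(\Omega^i k, M)\to \underline{\mathrm{Hom}}_{kG}(\Omega^i k,N)$ for all integers $i$ factors through a projective $kG$-module) if and only if $G$ is isomorphic to $C_2$ or $C_3$.
   Context: $\mathrm{StMod}(kG)$ is the stable module category: objects are left $kG$-modules (not necessarily finite-dimensional), and $\underline{\mathrm{Hom}}_{kG}(M,N)$ is the group of $kG$-module homomorphisms $M\to N$ modulo those factoring through a projective module. It is a tensor triangulated category with unit the trivial module $k$ and desuspension $\Omega$, where $\Omega M$ is the kernel of a projective cover of $M$. Tate cohomology is $\widehat{H}^i(G,M)\cong \underline{\mathrm{Hom}}_{kG}(\Omega^i k, M)$. A map $f\colon M\to N$ is a ghost if the induced map $\underline{\mathrm{Hom}}_{kG}(\Omega^i k,M)\to\underline{\mathrm{Hom}}_{kG}(\Omega^i k,N)$ is zero for all $i\in\mathbb{Z}$; it is trivial if it is zero in $\mathrm{StMod}(kG)$. *)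

(* Defs.v *)
From HB Require Import structures.
From mathcomp Require Import all_boot all_order all_algebra all_fingroup all_solvable.
Set Implicit Arguments. Unset Strict Implicit. Unset Printing Implicit Defensive.
Import GRing.Theory.
Local Open Scope ring_scope.

Section StMod.
Variables (k : fieldType) (gT : finGroupType) (G : {group gT}).

Record kGmod := KGmod {
  carrier : lmodType k;
  act : gT -> carrier -> carrier;
  act_linear : forall x, x \in G -> forall (a : k) (u v : carrier),
      act x (a *: u + v) = a *: act x u + act x v;
  act1 : forall v, act 1%g v = v;
  actM : forall x y, x \in G -> y \in G -> forall v, act (x * y)%g v = act x (act y v)
}.
Arguments act : clear implicits.

Definition is_hom (M N : kGmod) (f : carrier M -> carrier N) : Prop :=
  (forall (a : k) (u v : carrier M), f (a *: u + v) = a *: f u + f v) /\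
  (forall x, x \in G -> forall v, f (act M x v) = act N x (f v)).

Definition projective (P : kGmod) : Prop :=
  forall (A B : kGmod) (q : carrier A -> carrier B) (g : carrier P -> carrier B),
    is_hom q -> (forall b, exists a, q a = b) -> is_hom g ->
    exists h : carrier P -> carrier A, is_hom h /\ forall v, q (h v) = g v.

Definition stably_trivial (M N : kGmod) (f : carrier M -> carrier N) : Prop :=
  exists (P : kGmod) (a : carrier M -> carrier P) (b : carrier P -> carrier N),
    [/\ projective P, is_hom a, is_hom b & forall v, f v = b (a v)].

Definition triv_act (x : gT) (v : k^o) : k^o := v.
Lemma triv_act_linear x : x \in G -> forall (a : k) (u v : k^o),
  triv_act x (a *: u + v) = a *: triv_act x u + triv_act x v.
Proof. by []. Qed.
Lemma triv_act1 v : triv_act 1%g v = v. Proof. by []. Qed.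
Lemma triv_actM x y : x \in G -> y \in G -> forall v,
  triv_act (x * y)%g v = triv_act x (triv_act y v).
Proof. by []. Qed.
Definition trivial_mod : kGmod := KGmod triv_act_linear triv_act1 triv_actM.

Definition mod_iso (M N : kGmod) : Prop :=
  exists (f : carrier M -> carrier N) (g : carrier N -> carrier M),
    [/\ is_hom f, is_hom g, cancel f g & cancel g f].

Definition short_exact (A B C : kGmod)
    (i : carrier A -> carrier B) (q : carrier B -> carrier C) : Prop :=
  [/\ is_hom i, is_hom q, injective i, (forall c, exists b, q b = c) &
      forall b, q b = 0 <-> exists a, i a = b].

(* OmegaPos n L : L is an n-th syzygy of k (Omega^n k plus possibly a
   projective summand), obtained by iterating kernels of maps from projectives. *)
Fixpoint OmegaPos (n : nat) (L : kGmod) : Prop :=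
  match n with
  | 0%N => mod_iso L trivial_mod
  | n'.+1 => exists (L' P : kGmod) (i : carrier L -> carrier P)
               (q : carrier P -> carrier L'),
               [/\ projective P, OmegaPos n' L' & short_exact i q]
  end.

(* OmegaNeg n L : L is an n-th cosyzygy of k (Omega^{-n} k up to projectives). *)
Fixpoint OmegaNeg (n : nat) (L : kGmod) : Prop :=
  match n with
  | 0%N => mod_iso L trivial_mod
  | n'.+1 => exists (L' P : kGmod) (i : carrier L' -> carrier P)
               (q : carrier P -> carrier L),
               [/\ projective P, OmegaNeg n' L' & short_exact i q]
  end.

Definition Omega (n : int) (L : kGmod) : Prop :=
  match n with
  | Posz m => OmegaPos m L
  | Negz m => OmegaNeg m.+1 L
  end.

Definition ghost (M N : kGmod) (f : carrier M -> carrier N) : Prop :=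
  forall (n : int) (L : kGmod), Omega n L ->
  forall g : carrier L -> carrier M, is_hom g -> stably_trivial (fun v => f (g v)).

End StMod.

(* Main.v *)
(* A k-linear map theta between kG-modules has a trace, the sum over x in G of
   x theta x^-1, and a homomorphism is stably trivial if and only if it is such
   a trace (linear sections of surjections, obtained by Zorn's lemma, make this
   work for modules of any dimension).

   If G is neither C_2 nor C_3, it has an abelian subgroup A with #|A| >= 4, and
   A has an additive character lam : A -> F_p with lam(c) = 1 for some c.  Let A
   act on V = k^2 by the unipotent matrices [[1, lam], [0, 1]]; then c - 1 acts
   on V as the nilpotent matrix N = [[0, 1], [0, 0]].  On any syzygy L of k, the
   map c - 1 is A-linear and lifts the zero map of k, so it is stably trivial
   over A; hence N kills all maps L -> V, and by Frobenius reciprocity the map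
   coinduced by N from A to G is a ghost.  It is not stably trivial: otherwise N
   would be a trace over A, but the traces over A of endomorphisms of V have
   entries built from #|A|, the sum of lam and the sum of lam^2, all zero in k.

   If G is cyclic of order p = 2 or 3 with generator g and x = g - 1, the traces
   are the maps sum_i x^i theta x^(p - 1 - i).  Testing a ghost f on k, and for
   p = 3 on Omega k (the module k[x]/(x^2)), gives f(ker x^j) in im x^(p - j) for
   0 < j < p, from which theta is built using generalised inverses of powers of
   x, imitating the decomposition into cyclic k[x]-modules. *)
Require Import Defs.
From HB Require Import structures.
From mathcomp Require Import all_boot all_order all_algebra all_fingroup all_solvable.
From mathcomp Require Import ring.
From mathcomp Require boolp classical_sets.

Local Open Scope group_scope.

(** * Linear maps between spaces of any dimension, and their generalised inverses *)

Section LinearMaps.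

Set Implicit Arguments.
Unset Strict Implicit.
Unset Printing Implicit Defensive.
Import GRing.Theory.
Local Open Scope ring_scope.

Variable k : fieldType.
Implicit Types U V W : lmodType k.

Definition lin U V (f : U -> V) := forall a u v, f (a *: u + v) = a *: f u + f v.

Lemma linD U V (f : U -> V) : lin f -> forall u v, f (u + v) = f u + f v.
Proof. by move=> fL u v; rewrite -{1}[u]scale1r fL scale1r. Qed.

Lemma lin0 U V (f : U -> V) : lin f -> f 0 = 0.
Proof. by move=> fL; apply: (addrI (f 0)); rewrite -linD // !addr0. Qed.

Lemma linZ U V (f : U -> V) : lin f -> forall a u, f (a *: u) = a *: f u.
Proof. by move=> fL a u; rewrite -[a *: u]addr0 fL lin0 // addr0. Qed.

Lemma linN U V (f : U -> V) : lin f -> forall u, f (- u) = - f u.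
Proof. by move=> fL u; rewrite -scaleN1r linZ // scaleN1r. Qed.

Lemma linB U V (f : U -> V) : lin f -> forall u v, f (u - v) = f u - f v.
Proof. by move=> fL u v; rewrite linD // linN. Qed.

Lemma lin_sum U V (f : U -> V) : lin f -> forall I (r : seq I) P F,
  f (\sum_(i <- r | P i) F i) = \sum_(i <- r | P i) f (F i).
Proof. by move=> fL I r P F; exact: (big_morph f (linD fL) (lin0 fL)). Qed.

Lemma lin_comp U V W (g : V -> W) (f : U -> V) :
  lin g -> lin f -> lin (fun u => g (f u)).
Proof. by move=> gL fL a u v; rewrite fL gL. Qed.

Lemma lin_add U V (f g : U -> V) : lin f -> lin g -> lin (fun u => f u + g u).
Proof. by move=> fL gL a u v; rewrite fL gL scalerDr addrACA. Qed.

Lemma lin_sub U V (f g : U -> V) : lin f -> lin g -> lin (fun u => f u - g u).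
Proof. by move=> fL gL a u v; rewrite fL gL scalerBr opprD addrACA. Qed.

Lemma lin_bigsum U V (I : Type) (r : seq I) (P : pred I) (F : I -> U -> V) :
    (forall i, P i -> lin (F i)) -> lin (fun u => \sum_(i <- r | P i) F i u).
Proof.
move=> FL a u v; rewrite scaler_sumr -big_split.
by apply: eq_bigr => i Pi; rewrite FL.
Qed.

(* The graph of the generalised inverse is a maximal graph of a partial linear
   map V -> U that agrees with a right inverse of f on the image of f. *)
Lemma lin_ginv U V (f : U -> V) :
  lin f -> exists2 s : V -> U, lin s & forall u, f (s (f u)) = f u.
Proof.
move=> fL; pose W := (V * U)%type : lmodType k.
pose good (S : W -> Prop) :=
  [/\ forall a x y, S x -> S y -> S (a *: x + y),
      forall u, S (0, u) -> u = 0
    & forall u u', S (f u, u') -> f u' = f u].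
have [|S [[Slin Sfun Sinv] Smax]] := @classical_sets.Zorn_bigcup W good.
  move=> F Fgood Ftot; split.
  - move=> a x y [X FX Xx] [Y FY Yy].
    have [XY|YX] := Ftot _ _ FX FY.
      by exists Y => //; have [+ _ _] := Fgood _ FY; apply=> //; apply: XY.
    by exists X => //; have [+ _ _] := Fgood _ FX; apply=> //; apply: YX.
  - by move=> u [X FX Xu]; have [_ + _] := Fgood _ FX; apply.
  - by move=> u u' [X FX Xu]; have [_ _ +] := Fgood _ FX; apply.
(* [good] does not ask for 0, because the union of the empty chain has to be good. A maximal [S]
   contains 0, since adjoining 0 keeps it good. *)
have S0 : S 0.
  pose S' w := S w \/ w = 0.
  have [|nS] := boolp.pselect (S 0) => //; case: (Smax S').
    by split=> [w|/(_ 0 (or_intror erefl))//]; left.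
  split.
  - move=> a x y [Sx|->] [Sy|->]; rewrite ?scaler0 ?add0r ?addr0.
    + by left; apply: Slin.
    + case: (boolp.pselect (a = 0)) => [->|a0]; first by right; rewrite scale0r.
      left; have := Slin (a - 1) x x Sx Sx.
      by rewrite scalerBl scale1r subrK.
    + by left.
    + by right.
  - by move=> u [/Sfun//|[]].
  - by move=> u u' [/Sinv//|[-> ->]]; rewrite lin0.
have Stot v : exists u, S (v, u).
  have [//|nSv] := boolp.pselect (exists u, S (v, u)).
  (* [z] is the value to be given at [v]. If [w1 + v = f u1'] with [(w1, u1)] in [S], additivity
     suggests [u1' - u1]. Otherwise no sum of an element of the domain and a nonzero multiple of [v]
     lies in the image of [f], and 0 will do. *)
  have [z zP] : exists z : U, forall a w u' u, S (w, u') -> w + a *: v = f u ->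
      f (u' + a *: z) = w + a *: v.
    have [[[w1 u1] /= [u1' [Sw1 E1]]]|no] := boolp.pselect (exists p : W, exists u,
        S p /\ p.1 + v = f u).
      exists (u1' - u1) => a w u' u Sw E.
      have Sd : S ((- a) *: w1 + w, (- a) *: u1 + u') by apply: Slin Sw1 Sw.
      have Ed : (- a) *: w1 + w = f (u - a *: u1').
        by rewrite linB // linZ // -E -E1 scalerDr scaleNr opprD addrACA subrr addr0 addrC.
      rewrite Ed in Sd; have E2 := Sinv _ _ Sd.
      have -> : u' + a *: (u1' - u1) = (- a) *: u1 + u' + a *: u1'.
        by rewrite scalerBr scaleNr [RHS]addrC [RHS]addrA [RHS]addrC.
      by rewrite linD // E2 -linD // subrK.
    exists 0 => a w u' u Sw E; rewrite scaler0 addr0.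
    have [a0|a0] := eqVneq a 0.
      move: E; rewrite a0 scale0r addr0 => E; rewrite E; apply: Sinv.
      by rewrite -E.
    case: no; exists (a^-1 *: (w, u') + 0 : W), (a^-1 *: u); split.
      exact: Slin.
    rewrite linZ // -E scalerDr scalerA mulVf // scale1r /=.
    by rewrite addr0.
  pose S' (w : W) := exists a, S (w - a *: (v, z)).
  case: (Smax S').
    split=> [w Sw|sub]; first by exists 0; rewrite scale0r subr0.
    apply: nSv; exists z; apply: sub; exists 1.
    by rewrite scale1r subrr.
  have vD a u : S (- a *: v, u) -> a = 0.
    move=> Sv; apply/eqP/negP=> /negP a0; apply: nSv; exists (- a^-1 *: u).
    have : S (- a^-1 *: (- a *: v) + 0, - a^-1 *: u + 0) by apply: Slin Sv S0.
    by rewrite !addr0 scalerA mulrNN mulVf // scale1r.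
  split.
  - move=> a x y [b Sx] [c Sy]; exists (a * b + c).
    have := Slin a _ _ Sx Sy; rewrite scalerBr scalerA addrACA.
    by rewrite -opprD -scalerDl.
  - move=> u [a Su]; have Su' : S (0 - a *: v, u - a *: z) by [].
    move: Su'; rewrite sub0r -[- (a *: v)]scaleNr => Su'; have a0 := vD _ _ Su'.
    by move: Su'; rewrite a0 oppr0 !scale0r subr0; apply: Sfun.
  move=> u u' [a Su].
  by have := zP a (f u - a *: v) (u' - a *: z) u Su; rewrite !subrK; apply.
have [s sS] := boolp.choice Stot.
have Suniq v u u' : S (v, u) -> S (v, u') -> u = u'.
  move=> Su Su'; have : S (-1 *: v + v, -1 *: u' + u) by apply: Slin Su' Su.
  rewrite !scaleN1r addNr => /Sfun u'u.
  by apply/eqP; rewrite -subr_eq0 addrC u'u.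
exists s => [a u v|u].
  by apply: Suniq (sS _) _; apply: (Slin a (u, s u) (v, s v)).
by apply: Sinv (sS _).
Qed.

End LinearMaps.

(** * Relative traces, and Higman's criterion for projectivity *)

Section RelativeTrace.

Set Implicit Arguments.
Unset Strict Implicit.
Unset Printing Implicit Defensive.
Import GRing.Theory.
Local Open Scope ring_scope.

Variables (k : fieldType) (gT : finGroupType) (G : {group gT}).
Implicit Types (H A : {group gT}) (L M N P : kGmod k G).

Local Notation "x |> v" := (Defs.act x v) (at level 38, right associativity).

Definition equivariant (H : {group gT}) M N (f : carrier M -> carrier N) :=
  forall x, x \in H -> forall v, f (x |> v) = x |> f v.

Definition trace (H : {group gT}) M N (t : carrier M -> carrier N) v :=
  \sum_(x in H) x |> t (x^-1%g |> v).

Lemma act_lin M x : x \in G -> lin (fun v : carrier M => x |> v).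
Proof. by move=> xG a u v; apply: Defs.act_linear. Qed.
Arguments act_lin : clear implicits.
Arguments act_lin M [x].

Lemma act_mul M x y (v : carrier M) :
  x \in G -> y \in G -> (x * y)%g |> v = x |> y |> v.
Proof. by move=> xG yG; apply: Defs.actM. Qed.

Lemma act_one M (v : carrier M) : 1%g |> v = v.
Proof. exact: Defs.act1. Qed.

Lemma actKV M x (v : carrier M) : x \in G -> x |> x^-1%g |> v = v.
Proof. by move=> xG; rewrite -act_mul ?groupV // mulgV act_one. Qed.

Lemma actVK M x (v : carrier M) : x \in G -> x^-1%g |> x |> v = v.
Proof. by move=> xG; rewrite -act_mul ?groupV // mulVg act_one. Qed.

Lemma equivariantS H A M N (f : carrier M -> carrier N) :
  H \subset A -> equivariant A f -> equivariant H f.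
Proof. by move=> /subsetP HA fA x xH; apply: fA; apply: HA. Qed.

Lemma eq_trace H M N (t t' : carrier M -> carrier N) v :
  t =1 t' -> trace H t v = trace H t' v.
Proof. by move=> tt'; apply: eq_bigr => x _; rewrite tt'. Qed.

Lemma trace_lin H M N (t : carrier M -> carrier N) :
  H \subset G -> lin t -> lin (trace H t).
Proof.
move=> /subsetP HG tL; apply: lin_bigsum => x xH a u v; have xG := HG _ xH.
by rewrite (Defs.act_linear (groupVr xG)) tL (Defs.act_linear xG).
Qed.

Lemma trace_equivariant H M N (t : carrier M -> carrier N) :
  H \subset G -> equivariant H (trace H t).
Proof.
move=> /subsetP HG y yH v; rewrite /trace (lin_sum (act_lin _ (HG _ yH))).
rewrite (reindex_inj (mulgI y)) /=.
rewrite (eq_bigl (mem H)) => [|x]; last by rewrite /= groupMl.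
apply: eq_bigr => x xH; rewrite act_mul ?HG // invMg; congr (_ |> _ |> t _).
by rewrite act_mul ?groupV ?HG // actVK ?HG.
Qed.

Lemma trace_compl H L M N (b : carrier M -> carrier N) (t : carrier L -> carrier M) v :
  lin b -> equivariant H b -> b (trace H t v) = trace H (fun v => b (t v)) v.
Proof.
move=> bL bH; rewrite /trace (lin_sum bL).
by apply: eq_bigr => x xH; rewrite bH.
Qed.

Lemma trace_compr H L M N (a : carrier L -> carrier M) (t : carrier M -> carrier N) v :
  equivariant H a -> trace H t (a v) = trace H (fun v => t (a v)) v.
Proof. by move=> aH; apply: eq_bigr => x xH; rewrite aH ?groupV. Qed.

Lemma sum_rcosets (V : nmodType) H A (F : gT -> V) : H \subset A ->
  \sum_(x in A) F x = \sum_(X in rcosets H A) \sum_(x in H) F (x * repr X)%g.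
Proof.
move=> HA; rewrite (set_partition_big _ (rcosets_partition HA)).
apply: eq_bigr => _ /rcosetsP[y yA ->].
have {1}<- := rcoset_repr H y; move: (repr _) => r.
by rewrite -rcosetE big_imset //=; apply: in2W; apply: mulIg.
Qed.

(** Transitivity of the trace: [G] is a disjoint union of cosets [H r], and the sum over the
    representatives [r] is absorbed into [t']. *)
Lemma trace_sub H M N (t : carrier M -> carrier N) : H \subset G -> lin t ->
  exists2 t' : carrier M -> carrier N, lin t' & trace G t =1 trace H t'.
Proof.
move=> HG tL.
exists (fun v => \sum_(X in rcosets H G) repr X |> t ((repr X)^-1%g |> v)).
  apply: lin_bigsum => X /rcosetsP[y yG ->].
  have rG : repr (H :* y)%g \in G.
    have := mem_repr_rcoset H y => /rcosetP[h hH ->].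
    by rewrite groupM // (subsetP HG).
  by move=> a u v; rewrite (Defs.act_linear (groupVr rG)) tL (Defs.act_linear rG).
move=> v; rewrite /trace (sum_rcosets _ HG) exchange_big /=.
apply: eq_bigr => x xH; have xG := subsetP HG _ xH.
rewrite (lin_sum (act_lin _ xG)); apply: eq_bigr => X /rcosetsP[y yG ->].
have rG : repr (H :* y)%g \in G.
  have := mem_repr_rcoset H y => /rcosetP[h hH ->].
  by rewrite groupM // (subsetP HG).
by rewrite act_mul // invMg act_mul ?groupV.
Qed.

Lemma hom_lin M N (f : carrier M -> carrier N) : is_hom f -> lin f.
Proof. by case. Qed.

Lemma hom_equivariant M N (f : carrier M -> carrier N) : is_hom f -> equivariant G f.
Proof. by case. Qed.

Lemma trace_hom M N (t : carrier M -> carrier N) : lin t -> is_hom (trace G t).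
Proof. by move=> tL; split; [apply: trace_lin | apply: trace_equivariant]. Qed.

(** A lift that is merely linear comes from [lin_ginv]. Composing it with [t] and taking the trace
    makes it equivariant, and it remains a lift because the trace of [t] is the identity. *)
Lemma trace_projective P (t : carrier P -> carrier P) :
  lin t -> trace G t =1 id -> projective P.
Proof.
move=> tL t1 A B q g qh qs gh.
have [s sL sP] := lin_ginv (hom_lin qh).
exists (trace G (fun v => s (g (t v)))); split.
  by apply: trace_hom; apply: lin_comp sL (lin_comp (hom_lin gh) tL).
move=> v; rewrite (trace_compl _ _ (hom_lin qh) (hom_equivariant qh)).
rewrite -[in RHS](t1 v) (trace_compl _ _ (hom_lin gh) (hom_equivariant gh)).
apply: eq_trace => w; have [a <-] := qs (g (t w)); exact: sP.
Qed.

(** * A projective module that maps onto a given module *)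

Section FunctionModule.

Variable M : kGmod k G.

(** Only the argument is translated and the values are left alone, which makes the module free:
    under left translation by [G], the set [gT] is a union of regular orbits. *)
Definition fun_act (y : gT) (m : {ffun gT -> carrier M}) : {ffun gT -> carrier M} :=
  [ffun x => m (y^-1 * x)%g].

Fact fun_act_linear x : x \in G ->
  forall (a : k) u v, fun_act x (a *: u + v) = a *: fun_act x u + fun_act x v.
Proof. by move=> _ a u v; apply/ffunP => y; rewrite !ffunE. Qed.

Fact fun_act1 v : fun_act 1%g v = v.
Proof. by apply/ffunP => y; rewrite ffunE invg1 mul1g. Qed.

Fact fun_actM x y : x \in G -> y \in G ->
  forall v, fun_act (x * y)%g v = fun_act x (fun_act y v).
Proof. by move=> _ _ v; apply/ffunP => z; rewrite !ffunE invMg mulgA. Qed.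

Definition fun_mod : kGmod k G := KGmod fun_act_linear fun_act1 fun_actM.

Definition fun_eval (m : carrier fun_mod) : carrier M := \sum_(x in G) x |> m x.

Lemma fun_eval_hom : is_hom fun_eval.
Proof.
split=> [|y yG v].
  apply: lin_bigsum => x xG a u v.
  by rewrite -(Defs.act_linear xG) !ffunE.
rewrite /fun_eval (reindex_inj (mulgI y)) /= (lin_sum (act_lin _ yG)).
apply: eq_big => x; first by rewrite groupMl.
by rewrite groupMl // => xG; rewrite ffunE mulKg act_mul.
Qed.

Lemma fun_eval_surj b : exists a, fun_eval a = b.
Proof.
exists [ffun x => if x == 1%g then b else 0].
rewrite /fun_eval (bigD1 1%g) //= ffunE eqxx act_one big1 ?addr0 // => x.
by case/andP=> xG x1; rewrite ffunE (negPf x1) (lin0 (act_lin _ xG)).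
Qed.

(** The identity is the trace of the restriction of functions to chosen representatives [r] of the
    cosets [G x]: at [x], only the summand of [x r^-1] is nonzero. *)
Lemma fun_mod_projective : projective fun_mod.
Proof.
pose t (m : carrier fun_mod) : carrier fun_mod :=
  [ffun x => if x == repr (G :* x)%g then m x else 0].
have tL : lin t.
  move=> a u v; apply/ffunP => x; rewrite !ffunE.
  by case: eqP => // _; rewrite scaler0 addr0.
apply: (trace_projective tL) => m; apply/ffunP => x.
rewrite /trace sum_ffunE; pose r := repr (G :* x)%g.
have rP y : y \in G -> repr (G :* (y^-1 * x))%g = r.
  by move=> yG; rewrite rcosetM rcoset_id ?groupV.
have y0G : (x * r^-1)%g \in G.
  have := mem_repr_rcoset G x; rewrite -/r => /rcosetP[h hG ->].
  by rewrite invMg mulKVg groupV.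
have actE y : y \in G ->
    fun_act y (t (fun_act y^-1%g m)) x = if y == (x * r^-1)%g then m x else 0.
  move=> yG; rewrite !ffunE rP // invgK mulKVg; congr (if _ then _ else _).
  by apply/eqP/eqP => [<- | ->]; rewrite invMg invgK ?mulKVg ?mulgKV.
rewrite (bigD1 _ y0G) /= big1 => [|y /andP[yG yn]]; rewrite actE //.
  by rewrite eqxx addr0.
by rewrite (negPf yn).
Qed.

End FunctionModule.

(** Projectivity splits [fun_eval]; the splitting followed by evaluation at 1 is the required linear
    map. *)
Lemma projective_trace P :
  projective P -> exists2 t : carrier P -> carrier P, lin t & trace G t =1 id.
Proof.
move=> Pproj.
have idh : is_hom (id : carrier P -> carrier P) by [].
have [h [hh hP]] := Pproj _ _ _ _ (fun_eval_hom P) (@fun_eval_surj P) idh.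
exists (fun v => (h v : {ffun gT -> carrier P}) 1%g) => [a u v|v].
  by rewrite (hom_lin hh) !ffunE.
rewrite -[RHS]hP; apply: eq_bigr => x xG; congr (_ |> _).
by rewrite (hom_equivariant hh) ?groupV // ffunE invgK mulg1.
Qed.

(** The identity of a projective is a trace, and traces absorb homomorphisms on both sides.
    Conversely, a trace factors through [fun_mod N], as [fun_eval] of the function sending [x] to
    [t (x^-1 v)]. *)
Lemma stably_trivial_trace M N (f : carrier M -> carrier N) : stably_trivial f <->
  exists2 t : carrier M -> carrier N, lin t & f =1 trace G t.
Proof.
split=> [[P [a [b [Pproj ah bh fE]]]] | [t tL fE]].
  have [t tL t1] := projective_trace Pproj.
  exists (fun v => b (t (a v))).
    exact: lin_comp (hom_lin bh) (lin_comp tL (hom_lin ah)).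
  move=> v; rewrite fE -[a v]t1 (trace_compr _ _ (hom_equivariant ah)).
  by rewrite (trace_compl _ _ (hom_lin bh) (hom_equivariant bh)).
(* Elements outside [G] need not act linearly, hence the value 0 there. *)
exists (fun_mod N), (fun v => [ffun x => if x \in G then t (x^-1%g |> v) else 0]).
exists (@fun_eval N); split; [exact: fun_mod_projective | split | exact: fun_eval_hom |].
- move=> a u v; apply/ffunP => x; rewrite !ffunE; case: ifP => xG.
    by rewrite (Defs.act_linear (groupVr xG)) tL.
  by rewrite scaler0 addr0.
- move=> y yG v; apply/ffunP => x; rewrite !ffunE groupMl ?groupV //.
  by case: ifP => // xG; rewrite invMg invgK act_mul ?groupV.
move=> v; rewrite fE; apply: eq_bigr => x xG; by rewrite ffunE xG.
Qed.

(** * A central element of a subgroup, acting on the syzygies of [k] *)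

Section Syzygies.

Variables (A : {group gT}) (c : gT).
Hypotheses (AG : A \subset G) (cA : c \in A) (cC : c \in 'C(A)%g).

(** This says that [c - 1] is stably trivial on the restriction of [L] to [A]. *)
Definition shift_trace L :=
  exists2 t : carrier L -> carrier L, lin t & forall v, c |> v - v = trace A t v.

Let cG : c \in G. Proof. exact: (subsetP AG). Qed.

Lemma shift_lin L : lin (fun v : carrier L => c |> v - v).
Proof. by apply: lin_sub => // a u v; rewrite (Defs.act_linear cG). Qed.

Lemma shift_equivariant L : equivariant A (fun v : carrier L => c |> v - v).
Proof.
move=> x xA v; have xG := subsetP AG _ xA.
by rewrite (linB (act_lin L xG)) -!act_mul // (centP cC).
Qed.

Lemma shift_trace_trivial L : mod_iso L (trivial_mod k G) -> shift_trace L.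
Proof.
move=> [f [g [fh gh fK gK]]]; exists (fun=> 0) => [a u v|v].
  by rewrite scaler0 addr0.
rewrite /trace big1 => [|x xA]; last by rewrite (lin0 (act_lin _ (subsetP AG _ xA))).
by apply/eqP; rewrite subr_eq0 -(can_eq fK) (hom_equivariant fh).
Qed.

(** The trace [w] lifts [c - 1] from [L'] to a map [L' -> P] over [A]. Then [D = (c - 1) - w q]
    takes values in the image of [i], so it gives a map [P -> L] that restricts to [c - 1] on [L]. A
    map that extends to [P] is a trace, because the identity of [P] is one. *)
Lemma shift_trace_kernel L P L' (i : carrier L -> carrier P) (q : carrier P -> carrier L') :
  projective P -> short_exact i q -> shift_trace L' -> shift_trace L.
Proof.
move=> Pproj [ih qh i_inj qs ex] [t tL tP].
have [iL qL] := (hom_lin ih, hom_lin qh).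
have [iA qA] : equivariant A i /\ equivariant A q.
  by split; apply: equivariantS AG _; apply: hom_equivariant.
have [r0 r0L r01] := projective_trace Pproj.
have [r rL rE] := trace_sub AG r0L.
have [s sL sP] := lin_ginv qL.
have [i' i'L i'P] := lin_ginv iL.
pose w := trace A (fun v => s (t v)).
have wL : lin w by apply: trace_lin => //; apply: lin_comp sL tL.
have wA : equivariant A w by apply: trace_equivariant.
have qw v : q (w v) = c |> v - v.
  rewrite (trace_compl _ _ qL qA) tP; apply: eq_trace => u.
  by have [b <-] := qs (t u); apply: sP.
pose D (v : carrier P) : carrier P := c |> v - v - w (q v).
have DL : lin D by apply: lin_sub; [exact: shift_lin | exact: lin_comp wL qL].
have DA : equivariant A D.
  move=> x xA v; have xG := subsetP AG _ xA.
  rewrite /D (shift_equivariant xA) qA // wA //.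
  by rewrite [RHS](linB (act_lin P xG)).
have iD v : i (i' (D v)) = D v.
  have [a <-] : exists a, i a = D v; last exact: i'P.
  by apply/ex; rewrite linB // qw linB // (hom_equivariant qh) // subrr.
have i'DA : equivariant A (fun v => i' (D v)).
  by move=> x xA v; apply: i_inj; rewrite iD DA // iA // iD.
have i'DL : lin (fun v => i' (D v)) by apply: lin_comp.
exists (fun v => i' (D (r (i v)))) => [|v].
  exact: lin_comp i'DL (lin_comp rL iL).
rewrite -(trace_compr (fun u => i' (D (r u))) v iA).
rewrite -(trace_compl r (i v) i'DL i'DA) -rE r01.
apply: i_inj; rewrite iD /D (_ : q (i v) = 0); last by apply/ex; exists v.
by rewrite (lin0 wL) subr0 linB // (hom_equivariant ih).
Qed.

(** Dual to the kernel case: [w] extends [c - 1] from [L'] to [P], so [D = (c - 1) - i w] vanishes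
    on the image of [i] and descends to a map [L -> P] that lifts [c - 1]. *)
Lemma shift_trace_cokernel L P L' (i : carrier L' -> carrier P) (q : carrier P -> carrier L) :
  projective P -> short_exact i q -> shift_trace L' -> shift_trace L.
Proof.
move=> Pproj [ih qh i_inj qs ex] [t tL tP].
have [iL qL] := (hom_lin ih, hom_lin qh).
have [iA qA] : equivariant A i /\ equivariant A q.
  by split; apply: equivariantS AG _; apply: hom_equivariant.
have [r0 r0L r01] := projective_trace Pproj.
have [r rL rE] := trace_sub AG r0L.
have [s sL sP] := lin_ginv qL.
have [i' i'L i'P] := lin_ginv iL.
have i'K v : i' (i v) = v by apply: i_inj; apply: i'P.
have qs' v : q (s v) = v by have [b <-] := qs v; apply: sP.
pose w := trace A (fun v => t (i' v)).
have wL : lin w by apply: trace_lin => //; apply: lin_comp tL i'L.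
have wA : equivariant A w by apply: trace_equivariant.
have wi v : w (i v) = c |> v - v.
  by rewrite /w (trace_compr _ _ iA) tP; apply: eq_trace => u; rewrite i'K.
pose D (v : carrier P) : carrier P := c |> v - v - i (w v).
have DL : lin D by apply: lin_sub; [exact: shift_lin | exact: lin_comp iL wL].
have DA : equivariant A D.
  move=> x xA v; have xG := subsetP AG _ xA.
  rewrite /D (shift_equivariant xA) wA // iA //.
  by rewrite [RHS](linB (act_lin P xG)).
have Dq u v : q u = q v -> D u = D v.
  move=> quv; apply/eqP; rewrite -subr_eq0 -linB //.
  have [a <-] : exists a, i a = u - v by apply/ex; rewrite linB // quv subrr.
  by rewrite /D wi linB // (hom_equivariant ih) // subrr.
have DsA : equivariant A (fun v => D (s v)).
  by move=> x xA v; rewrite -DA //; apply: Dq; rewrite qA // !qs'.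
have DsL : lin (fun v => D (s v)) by apply: lin_comp.
exists (fun v => q (r (D (s v)))) => [|v].
  exact: lin_comp qL (lin_comp rL DsL).
rewrite -(trace_compl (fun v => r (D (s v))) v qL qA) -(trace_compr r v DsA) -rE r01.
rewrite linB // linB // (hom_equivariant qh) // qs' (_ : q (i _) = 0) ?subr0 //.
by apply/ex; exists (w (s v)).
Qed.

Lemma shift_trace_Omega n L : Omega n L -> shift_trace L.
Proof.
case: n => n; rewrite /Omega.
  elim: n L => [|n IHn] L /=; first exact: shift_trace_trivial.
  by move=> [L' [P [i [q [Pproj /IHn tL' ex]]]]]; apply: shift_trace_kernel ex tL'.
(* Generalising the index lets the induction start from the trivial module. *)
move: n.+1 => m; elim: m L => [|m IHm] L /=; first exact: shift_trace_trivial.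
by move=> [L' [P [i [q [Pproj /IHm tL' ex]]]]]; apply: shift_trace_cokernel ex tL'.
Qed.

End Syzygies.

End RelativeTrace.

Arguments act_lin [k gT G] M [x].

(** * The unipotent action on a plane *)

Section Shear.

Set Implicit Arguments.
Unset Strict Implicit.
Unset Printing Implicit Defensive.
Import GRing.Theory.
Local Open Scope ring_scope.

Variables (k : fieldType) (gT : finGroupType) (A : {group gT}) (lam : gT -> k).

Definition plane : lmodType k := (k^o * k^o)%type.

Definition shear (a : gT) (w : plane) : plane := (w.1 + lam a * w.2, w.2).

Definition nilp (w : plane) : plane := (w.2, 0).

Lemma shear_lin a : lin (shear a).
Proof.
have E (b l u1 u2 v1 v2 : k) :
    b * u1 + v1 + l * (b * u2 + v2) = b * (u1 + l * u2) + (v1 + l * v2).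
  by rewrite !mulrDr addrACA (mulrCA l).
by move=> b u v; congr (_, _); apply: E.
Qed.

Lemma nilp_lin : lin nilp.
Proof.
have E (b : k) : 0 = b * 0 + 0 by rewrite mulr0 addr0.
by move=> b u v; congr (_, _); apply: E.
Qed.

Lemma nilp_shear a w : nilp (shear a w) = shear a (nilp w).
Proof. by rewrite /nilp /shear /= mulr0 addr0. Qed.

Lemma shear_nilp a w : lam a = 1 -> shear a w - w = nilp w.
Proof.
by move=> a1; rewrite /shear /nilp a1 mul1r; congr (_, _); rewrite /= ?subrr // addrC addKr.
Qed.

Hypothesis lamM : {in A &, forall a b, lam (a * b)%g = lam a + lam b}.

Lemma shearM : {in A &, forall a b w, shear (a * b)%g w = shear a (shear b w)}.
Proof.
by move=> a b aA bA w; rewrite /shear lamM //= mulrDl addrA addrAC.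
Qed.

Lemma lam1 : lam 1%g = 0.
Proof. by apply: (addrI (lam 1%g)); rewrite -lamM // mulg1 addr0. Qed.

Lemma lamV a : a \in A -> lam a^-1%g = - lam a.
Proof. by move=> aA; apply/eqP; rewrite -addr_eq0 -lamM ?groupV // mulVg lam1. Qed.

Lemma shear1 w : shear 1%g w = w.
Proof. by rewrite /shear lam1 mul0r addr0 -surjective_pairing. Qed.

Hypothesis cardA0 : #|A|%:R = 0 :> k.
Hypothesis sum_lam : \sum_(a in A) lam a = 0.
Hypothesis sum_lam2 : \sum_(a in A) lam a ^+ 2 = 0.

(** Only upper right matrix entries are compared: that of [nilp] is 1, while that of the trace is a
    combination of the three vanishing sums, with coefficients from the matrix of [t]. *)
Lemma nilp_not_trace (t : plane -> plane) : lin t ->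
  ~ (forall w, nilp w = \sum_(a in A) shear a (t (shear a^-1%g w))).
Proof.
move=> tL /(_ (0, 1)) /(congr1 fst) /=.
rewrite (raddf_sum (fst : {additive plane -> k^o})) /=.
pose e1 : plane := (1, 0); pose e2 : plane := (0, 1).
pose F a : k := (t e2).1 + lam a * ((t e2).2 - (t e1).1) - lam a ^+ 2 * (t e1).2.
rewrite (eq_bigr F) => [|a aA].
  rewrite /F sumrB big_split /= -!mulr_suml sum_lam sum_lam2 !mul0r addr0 subr0.
  rewrite sumr_const -mulr_natl cardA0 mul0r => /eqP.
  by rewrite (oner_eq0 k).
have -> : shear a^-1%g (0, 1) = - lam a *: e1 + e2.
  rewrite /shear lamV //=; congr (_, _); rewrite /= ?mulr1 ?scaler0 add0r //.
  by rewrite addr0 /GRing.scale /= mulr1.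
have E (l p1 p2 q1 q2 : k) :
    - l * p1 + q1 + l * (- l * p2 + q2) = q1 + l * (q2 - p1) - l ^+ 2 * p2.
  by ring.
by rewrite tL; apply: E.
Qed.

End Shear.

(** * Coinduction of the plane from [A] to [G] *)

Section Coinduced.

Set Implicit Arguments.
Unset Strict Implicit.
Unset Printing Implicit Defensive.
Import GRing.Theory.
Local Open Scope ring_scope.

Variables (k : fieldType) (gT : finGroupType) (G A : {group gT}) (lam : gT -> k).

Local Notation V := (plane k).
Local Notation shear := (shear lam).
Local Notation "x |> v" := (Defs.act x v) (at level 38, right associativity).

(** The [A]-equivariant functions from [G] to the plane, extended by 0 to [gT]; [G] will act by
    right translation. *)
Definition coind_pred : {pred {ffun gT -> V}} :=
  fun m => [forall x, (x \notin G) ==> (m x == 0)] &&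
           [forall a in A, forall x, m (a * x)%g == shear a (m x)].

Lemma coind_predP (m : {ffun gT -> V}) :
  reflect ((forall x, x \notin G -> m x = 0) /\
           (forall a x, a \in A -> m (a * x)%g = shear a (m x)))
          (m \in coind_pred).
Proof.
apply: (iffP andP) => [[/forallP m0 /forall_inP mA] | [m0 mA]]; split.
- by move=> x xG; apply/eqP/(implyP (m0 x)).
- by move=> a x aA; apply/eqP/(forallP (mA a aA)).
- by apply/forallP => x; apply/implyP => xG; rewrite m0.
- by apply/forall_inP => a aA; apply/forallP => x; rewrite mA.
Qed.

Fact coind_submod_closed : submod_closed coind_pred.
Proof.
split=> [|b u v /coind_predP[u0 uA] /coind_predP[v0 vA]]; apply/coind_predP; split.
- by move=> x _; rewrite ffunE.
- by move=> a x _; rewrite !ffunE (lin0 (shear_lin lam a)).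
- by move=> x xG; rewrite !ffunE u0 // v0 // scaler0 addr0.
- by move=> a x aA; rewrite !ffunE uA // vA // shear_lin.
Qed.

HB.instance Definition _ := GRing.isSubmodClosed.Build k {ffun gT -> V} coind_pred
  coind_submod_closed.

Record coind := Coind {coind_val : {ffun gT -> V}; _ : coind_val \in coind_pred}.

HB.instance Definition _ := [isSub for coind_val].
HB.instance Definition _ := [Choice of coind by <:].
HB.instance Definition _ := [SubChoice_isSubLmodule of coind by <:].

(** The default [m] can occur only for [y] outside [G], where a translate may have the wrong
    support. *)
Definition coind_act (y : gT) (m : coind) : coind :=
  insubd m [ffun x => val m (x * y)%g].

Lemma coind_val0 (m : coind) x : x \notin G -> val m x = 0.
Proof. by case: m => m /= /coind_predP[m0 _]; apply: m0. Qed.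

Lemma coind_valA (m : coind) a x : a \in A -> val m (a * x)%g = shear a (val m x).
Proof. by case: m => m /= /coind_predP[_]; apply. Qed.

Lemma coind_actE y m x : y \in G -> val (coind_act y m) x = val m (x * y)%g.
Proof.
move=> yG; rewrite insubdK ?ffunE //; apply/coind_predP; split=> [z zG|a z aA].
  rewrite ffunE (coind_val0 m) // groupMr //.
by rewrite !ffunE -mulgA (coind_valA _ _ aA).
Qed.

Lemma coindP (m m' : coind) : (forall x, x \in G -> val m x = val m' x) -> m = m'.
Proof.
move=> mm'; apply/val_inj/ffunP => x.
have [xG|xG] := boolP (x \in G); first exact: mm'.
by rewrite (coind_val0 m xG) (coind_val0 m' xG).
Qed.

Fact coind_act_linear y : y \in G ->
  forall (b : k) u v, coind_act y (b *: u + v) = b *: coind_act y u + coind_act y v.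
Proof. by move=> yG b u v; apply: coindP => x _; rewrite !(coind_actE, ffunE). Qed.

Fact coind_act1 v : coind_act 1%g v = v.
Proof. by apply: coindP => x _; rewrite coind_actE // mulg1. Qed.

Fact coind_actM x y : x \in G -> y \in G ->
  forall v, coind_act (x * y)%g v = coind_act x (coind_act y v).
Proof.
by move=> xG yG v; apply: coindP => z _; rewrite !coind_actE ?groupM // mulgA.
Qed.

Definition coind_mod : kGmod k G := KGmod coind_act_linear coind_act1 coind_actM.

Definition coind_nilp (m : coind) : coind := insubd m [ffun x => nilp (val m x)].

Lemma coind_nilpE m x : val (coind_nilp m) x = nilp (val m x).
Proof.
rewrite insubdK ?ffunE //; apply/coind_predP; split=> [z zG|a z aA].
  by rewrite ffunE coind_val0.
by rewrite !ffunE coind_valA // nilp_shear.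
Qed.

Lemma coind_nilp_hom : @is_hom _ _ _ coind_mod coind_mod coind_nilp.
Proof.
split=> [b u v|y yG v]; apply: coindP => x _.
  by rewrite !(coind_nilpE, ffunE) nilp_lin.
by rewrite !(coind_nilpE, coind_actE).
Qed.

Hypotheses (AG : A \subset G).
Hypothesis lamM : {in A &, forall a b, lam (a * b)%g = lam a + lam b}.

(** Together with [coind_eval], this makes the plane a direct summand of the restriction of
    [coind_mod] to [A]. *)
Definition coind_inj (w : V) : coind :=
  insubd 0 [ffun x => if x \in A then shear x w else 0].

Lemma coind_injE w x : val (coind_inj w) x = if x \in A then shear x w else 0.
Proof.
rewrite insubdK ?ffunE //; apply/coind_predP; split=> [z zG|a z aA].
  by rewrite ffunE ifN //; apply: contra zG; apply: (subsetP AG).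
rewrite !ffunE groupMl //; case: ifP => zA; first exact: (shearM lamM).
by rewrite (lin0 (shear_lin lam a)).
Qed.

Lemma coind_inj_lin : lin coind_inj.
Proof.
move=> b u v; apply: coindP => x _; rewrite !(coind_injE, ffunE).
by case: ifP => _; [apply: shear_lin | rewrite scaler0 addr0].
Qed.

Lemma coind_inj_equivariant a w :
  a \in A -> coind_inj (shear a w) = (a |> (coind_inj w : carrier coind_mod)).
Proof.
move=> aA; apply: coindP => x _; rewrite coind_actE ?(subsetP AG) // !coind_injE groupMr //.
by case: ifP => // xA; rewrite (shearM lamM).
Qed.

Definition coind_eval (m : coind) : V := val m 1%g.

Lemma coind_eval_equivariant a (m : carrier coind_mod) :
  a \in A -> coind_eval (a |> m) = shear a (coind_eval m).
Proof.
move=> aA; rewrite /coind_eval coind_actE ?(subsetP AG) //.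
by rewrite mul1g -[a in LHS]mulg1 (coind_valA _ _ aA).
Qed.

Lemma coind_eval_lin : lin coind_eval.
Proof. by move=> b u v; rewrite /coind_eval !ffunE. Qed.

Lemma coind_evalK w : coind_eval (coind_inj w) = w.
Proof. by rewrite /coind_eval coind_injE group1 (shear1 lamM). Qed.

(** By Frobenius reciprocity [h] is determined by [coind_eval h], and [nilp] after this map equals
    [coind_eval h (c - 1)]. Since [c - 1] is the trace over [A] of [t], the composite of [h] and
    [coind_nilp] is the trace over [G] of [coind_inj coind_eval h t]. *)
Lemma coind_nilp_ghost c : c \in A -> c \in 'C(A)%g -> lam c = 1 ->
  @ghost _ _ _ coind_mod coind_mod coind_nilp.
Proof.
move=> cA cC c1 n L /(shift_trace_Omega AG cA cC)[t tL tP] h hh.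
have evL := coind_eval_lin; have hL := hom_lin hh.
apply/stably_trivial_trace; exists (fun v => coind_inj (coind_eval (h (t v)))).
  exact: lin_comp coind_inj_lin (lin_comp evL (lin_comp hL tL)).
move=> v; apply: coindP => x xG; rewrite coind_nilpE.
have -> : val (h v) x = coind_eval (h (x |> v)).
  by rewrite (hom_equivariant hh) // /coind_eval coind_actE // mul1g.
rewrite -(shear_nilp _ c1) -coind_eval_equivariant // -(linB evL).
rewrite -(hom_equivariant hh) ?(subsetP AG) // -linB // tP.
rewrite /trace (lin_sum hL) (lin_sum evL).
rewrite (raddf_sum (val : coind -> {ffun gT -> V})) sum_ffunE.
(* At [x], the summand of [x^-1 a] evaluates [coind_inj] at [a], so only [a] in [A] contributes. *)
rewrite [RHS](reindex_inj (mulgI x^-1%g)) /=.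
rewrite [LHS]big_mkcond [RHS]big_mkcond /=; apply: eq_bigr => a _.
rewrite groupMl ?groupV //.
have [aA|aA] := boolP (a \in A); last first.
  by case: ifP => // aG; rewrite coind_actE ?groupM ?groupV // coind_injE mulKVg (negPf aA).
have aG := subsetP AG _ aA; rewrite aG coind_actE ?groupM ?groupV // coind_injE mulKVg aA.
rewrite (hom_equivariant hh) // coind_eval_equivariant // invMg invgK.
by rewrite act_mul ?groupV.
Qed.

(** Compressing by [coind_inj] and [coind_eval] would turn a trace for [coind_nilp] into a trace
    over [A] for [nilp]. *)
Lemma coind_nilp_nontrivial :
    #|A|%:R = 0 :> k -> \sum_(a in A) lam a = 0 -> \sum_(a in A) lam a ^+ 2 = 0 ->
  ~ @stably_trivial _ _ _ coind_mod coind_mod coind_nilp.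
Proof.
move=> A0 S1 S2 /stably_trivial_trace[t0 t0L ft0].
have [t tL tE] := trace_sub AG t0L.
apply: (@nilp_not_trace _ _ _ lam lamM A0 S1 S2 (fun w => coind_eval (t (coind_inj w)))).
  exact: lin_comp coind_eval_lin (lin_comp tL coind_inj_lin).
move=> w; rewrite -[in LHS](coind_evalK w) /coind_eval -coind_nilpE.
rewrite ft0 tE -/(coind_eval _) (lin_sum coind_eval_lin); apply: eq_bigr => a aA.
by rewrite coind_eval_equivariant // -coind_inj_equivariant ?groupV.
Qed.

End Coinduced.

(** * Additive characters of p-groups whose first two power sums vanish *)

Section AdditiveCharacter.

Set Implicit Arguments.
Unset Strict Implicit.
Unset Printing Implicit Defensive.
Import GRing.Theory.
Local Open Scope ring_scope.

Variables (k : fieldType) (p : nat) (gT : finGroupType) (A : {group gT}).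
Hypotheses (p_pr : prime p) (pA : p.-group%g A) (charkp : p \in [pchar k]).

Lemma natr_eq_mod m n : m = n %[mod p] -> m%:R = n%:R :> k.
Proof.
move=> mn; rewrite (divn_eq m p) (divn_eq n p) mn !natrD !natrM.
by rewrite (pcharf0 charkp) !mulr0.
Qed.

Lemma pgroup_card0 (H : {group gT}) : p.-group%g H -> H :!=: 1%g -> #|H|%:R = 0 :> k.
Proof.
move=> pH H1; have [_ pdvd _] := pgroup_pdiv pH H1.
by apply/eqP; rewrite -(dvdn_pcharf charkp).
Qed.

Hypothesis A1 : A :!=: 1%g.

(** A maximal subgroup [K] has index [p]; [lam] is the exponent, read in [k], with respect to a
    generator of [A / K], and [c] is a preimage of that generator. *)
Lemma additive_character : exists (K : {group gT}) (c : gT) (lam : gT -> k),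
  [/\ K <| A, #|A : K|%g = p, c \in A, lam c = 1 &
      {in A &, forall a b, lam (a * b)%g = lam a + lam b} /\ {in K, forall a, lam a = 0}].
Proof.
have [A1'|[K Kmax _]] := maximal_exists (sub1G A).
  by case/eqP: A1; rewrite -A1'.
have KA := p_maximal_normal pA Kmax; have indK := p_maximal_index pA Kmax.
have cardAK : #|(A / K)%g| = p by rewrite card_quotient ?normal_norm.
have /cyclicP[x Ax] : cyclic (A / K) by rewrite prime_cyclic ?cardAK.
have ox : #[x]%g = p by rewrite -cardAK Ax.
have /morphimP[c cN cA xc] : x \in (A / K)%g by rewrite Ax cycle_id.
pose lam a : k := if [pick i : 'I_p | coset K a == x ^+ i]%g is Some i then i%:R else 0.
have lamE a n : a \in A -> coset K a = (x ^+ n)%g -> lam a = n%:R.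
  move=> aA an; rewrite /lam; case: pickP => [i /eqP|none].
    rewrite an => /eqP; rewrite eq_expg_mod_order ox eq_sym => /eqP.
    exact: natr_eq_mod.
  have np : (n %% p < p)%N by rewrite ltn_mod prime_gt0.
  by have := none (Ordinal np); rewrite /= an -ox expg_mod_order eqxx.
have AN := subsetP (normal_norm KA).
exists K, c, lam; split=> //; first exact: (lamE c 1%N).
split=> [a b aA bA|a aK]; last first.
  have aA := subsetP (normal_sub KA) _ aK.
  by apply: (lamE a 0%N) => //; rewrite coset_id.
have inX y : y \in A -> exists n, coset K y = (x ^+ n)%g.
  by move=> yA; apply/cycleP; rewrite -Ax mem_quotient.
have [[m am] [n bn]] := (inX a aA, inX b bA).
rewrite (lamE a m) // (lamE b n) // -natrD; apply: lamE; first exact: groupM.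
by rewrite morphM ?AN //= am bn expgD.
Qed.

(** If [p <= 4], then [K] is non-trivial and [lam] is constant on its cosets, whose size is 0 in
    [k]. If [p > 4], then 2 and 3 are invertible, and invariance of the power sums under translation
    by [c] suffices. *)
Lemma balanced_additive_character : (4 < p)%N || (p < #|A|)%N ->
  exists (c : gT) (lam : gT -> k),
  [/\ c \in A, lam c = 1, {in A &, forall a b, lam (a * b)%g = lam a + lam b},
      \sum_(a in A) lam a = 0 & \sum_(a in A) lam a ^+ 2 = 0].
Proof.
move=> largeA; have [K [c [lam [KA indK cA c1 [lamM lamK]]]]] := additive_character.
exists c, lam; have KsA := normal_sub KA.
have A0 := pgroup_card0 pA A1.
have [p4|p_small] := ltnP 4 p; last first.
  have K0 : #|K|%:R = 0 :> k.
    apply: pgroup_card0 (pgroupS KsA pA) _; apply: contraTneq largeA => K1.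
    by rewrite -(Lagrange KsA) indK K1 cards1 mul1n ltnn ltnNge p_small.
  have sumK (F : k -> k) : \sum_(a in A) F (lam a) = 0.
    rewrite (sum_rcosets _ KsA) big1 // => _ /rcosetsP[y yA ->].
    have rA : repr (K :* y)%g \in A.
      have := mem_repr_rcoset K y => /rcosetP[h hK ->].
      by rewrite groupM // (subsetP KsA).
    rewrite (eq_bigr (fun=> F (lam (repr (K :* y)%g)))) => [|a aK].
      by rewrite sumr_const -mulr_natl K0 mul0r.
    by rewrite (lamM _ _ (subsetP KsA _ aK) rA) lamK // add0r.
  by split=> //; [apply: (sumK id) | apply: (sumK (fun x => x ^+ 2))].
have shiftc (F : k -> k) : \sum_(a in A) F (lam a) = \sum_(a in A) F (1 + lam a).
  rewrite (reindex_inj (mulgI c)) /=; apply: eq_big => a; first by rewrite groupMl.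
  by rewrite groupMl // => aA; rewrite lamM // c1.
have small n : (0 < n < p)%N -> n%:R != 0 :> k.
  by case/andP=> n0 np; rewrite -(dvdn_pcharf charkp) gtnNdvd.
(* Taking F x = x ^ 2 and then F x = x ^ 3, and using #|A| = 0 in k, gives
   2 S1 = 0 and then 3 S2 = 0. *)
have S1 : \sum_(a in A) lam a = 0.
  have := shiftc (fun x => x ^+ 2).
  have square x : (1 + x) ^+ 2 = 1 + 2%:R * x + x ^+ 2 :> k by ring.
  under [RHS]eq_bigr do rewrite square.
  rewrite !big_split /= sumr_const A0 -!mulr_sumr add0r.
  rewrite -{1}[LHS]add0r => /addIr/esym/eqP; rewrite mulf_eq0.
  by rewrite (negPf (small 2%N _)) ?(ltn_trans _ p4) //= => /eqP.
have := shiftc (fun x => x ^+ 3).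
have cube x : (1 + x) ^+ 3 = 1 + 3%:R * x + 3%:R * x ^+ 2 + x ^+ 3 :> k by ring.
under [RHS]eq_bigr do rewrite cube.
rewrite !big_split /= sumr_const A0 -!mulr_sumr S1 mulr0 !add0r.
rewrite -{1}[LHS]add0r => /addIr/esym/eqP; rewrite mulf_eq0.
by rewrite (negPf (small 3%N _)) ?(ltn_trans _ p4) //= => /eqP.
Qed.

End AdditiveCharacter.

(** The centre serves for [p > 4]. For [p] equal to 2 or 3, the order of [G] is at least [p ^ 2],
    and a subgroup of order [p ^ 2] is abelian. *)
Lemma abelian_subgroup_exists (p : nat) (gT : finGroupType) (G : {group gT}) :
    prime p -> p.-group G -> G :!=: 1 -> ~ (G \isog Zp 2 \/ G \isog Zp 3) ->
  exists A : {group gT},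
    [/\ A \subset G, abelian A, A :!=: 1 & (4 < p)%N || (p < #|A|)%N].
Proof.
move=> p_pr pG G1 nG; have [_ _ [n cardG]] := pgroup_pdiv pG G1.
have [p4|p4] := ltnP 4 p.
  exists 'Z(G)%G; rewrite center_sub center_abelian; split=> //.
  by rewrite (center_nil_eq1 (pgroup_nil pG)).
have n0 : (0 < n)%N.
  rewrite lt0n; apply/eqP => n0; apply: nG; rewrite n0 expn1 in cardG.
  have cG : cyclic G by rewrite prime_cyclic ?cardG.
  have isoG : G \isog Zp p.
    have cardZp : #|Zp p| = p by rewrite card_Zp ?prime_gt0.
    by rewrite isog_cyclic_card // prime_cyclic cardZp // cardG eqxx.
  have p1 := prime_gt1 p_pr.
  case: p p_pr p4 isoG p1 {pG cardG} => [|[|[|[|[|p]]]]] // _ _ isoG _; first by left.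
  by right.
have [A [AG _ cardA]] : exists A : {group gT}, [/\ A \subset G, A <| G & #|A| = (p ^ 2)%N].
  by apply: normal_pgroup => //; rewrite cardG pfactorK.
have pp2 : (p < #|A|)%N by rewrite cardA -[X in (X < _)%N]expn1 ltn_exp2l ?prime_gt1.
exists A; split=> //; first exact: card_p2group_abelian cardA.
apply: contraTneq pp2 => ->; rewrite cards1 -leqNgt prime_gt0 //.
Qed.

(** * Solving the trace equation for nilpotent operators *)

Section NilpotentOperators.

Set Implicit Arguments.
Unset Strict Implicit.
Unset Printing Implicit Defensive.
Import GRing.Theory.
Local Open Scope ring_scope.

Variables (k : fieldType) (M N : lmodType k) (x : M -> M) (y : N -> N) (f : M -> N).
Hypotheses (xL : lin x) (yL : lin y) (fL : lin f) (fx : forall m, f (x m) = y (f m)).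

(** For a generalised inverse [T] of [x], the map [u = 1 - (x T + T x)] has values in the kernel of
    [x] and vanishes on its image. Hence [f u] can be divided by [y], and the remainder is handled
    by [f T]. *)
Lemma square_zero_decomposition :
    (forall m, x (x m) = 0) -> (forall m, x m = 0 -> exists n, f m = y n) ->
  exists2 t : M -> N, lin t & forall v, f v = y (t v) + t (x v).
Proof.
move=> xx0 ker1.
have [T TL TP] := lin_ginv xL; have [s sL sP] := lin_ginv yL.
pose u v := v - (x (T v) + T (x v)).
have uL : lin u.
  apply: lin_sub => //; apply: lin_add; first exact: lin_comp xL TL.
  exact: lin_comp TL xL.
have xu v : x (u v) = 0 by rewrite linB // linD // xx0 add0r TP subrr.
have ux v : u (x v) = 0 by rewrite /u TP xx0 (lin0 TL) addr0 subrr.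
have fu v : y (s (f (u v))) = f (u v) by have [n ->] := ker1 _ (xu v).
exists (fun v => f (T v) + s (f (u v))) => [|v].
  by apply: lin_add; [exact: lin_comp fL TL | exact: lin_comp sL (lin_comp fL uL)].
rewrite ux (lin0 fL) (lin0 sL) addr0 (linD yL) fu -fx addrAC -!linD //.
by rewrite /u addrC subrK.
Qed.

(* The operator e below projects M onto its free part over k[X]/(X^3), u = 1 - e
   onto the remaining part, where x ^ 2 = 0, and e2 = x u S u + u S u x onto the
   k[X]/(X^2)-part of the latter. *)
Lemma cube_zero_decomposition :
    (forall m, x (x (x m)) = 0) -> (forall m, x m = 0 -> exists n, f m = y (y n)) ->
    (forall m, x (x m) = 0 -> exists n, f m = y n) ->
  exists2 t : M -> N, lin t & forall v, f v = y (y (t v)) + y (t (x v)) + t (x (x v)).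
Proof.
move=> xxx0 ker1 ker2; have xxL := lin_comp xL xL; have yyL := lin_comp yL yL.
have [T TL /= TP] := lin_ginv xxL.
have [s1 s1L s1P] := lin_ginv yL; have [s2 s2L /= s2P] := lin_ginv yyL.
pose e v := x (x (T v)) + x (T (x v)) + T (x (x v)).
have eL : lin e.
  apply: lin_add; last exact: lin_comp TL xxL.
  by apply: lin_add; [exact: lin_comp xxL TL | exact: lin_comp xL (lin_comp TL xL)].
pose u v := v - e v.
have uL : lin u by apply: lin_sub.
have ux v : u (x v) = x (u v).
  rewrite /u /e linB // !(linD xL) xxx0 (lin0 TL) !xxx0 add0r addr0.
  by [].
have xxu v : x (x (u v)) = 0.
  by rewrite /u /e !linB // !(linD xL) !xxx0 !add0r TP subrr.
have xuL : lin (fun v => x (u v)) by apply: lin_comp.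
have [S SL /= SP] := lin_ginv xuL.
have uSuL : lin (fun v => u (S (u v))) by apply: lin_comp uL (lin_comp SL uL).
pose e2 v := x (u (S (u v))) + u (S (u (x v))).
have e2L : lin e2 by apply: lin_add; [exact: lin_comp xL uSuL | exact: lin_comp uSuL xL].
pose u2 v := u v - e2 v.
have u2L : lin u2 by apply: lin_sub.
have xu2 v : x (u2 v) = 0.
  by rewrite /u2 /e2 (linB xL) (linD xL) xxu add0r ux SP subrr.
have u2x v : u2 (x v) = 0.
  by rewrite /u2 /e2 !ux SP xxu (lin0 SL) (lin0 uL) addr0 subrr.
have fu v : y (s1 (f (u v))) = f (u v) by have [n ->] := ker2 _ (xxu v).
have fu2 v : y (y (s2 (f (u2 v)))) = f (u2 v) by have [n ->] := ker1 _ (xu2 v).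
(* One term per piece: [f] is not divided on the free part, is divided by [y] where [x ^ 2]
   vanishes, and by [y ^ 2] where [x] vanishes. *)
pose t v := f (T v) + s1 (f (u (S (u v)))) + s2 (f (u2 v)).
exists t => [|v].
  apply: lin_add; last exact: lin_comp s2L (lin_comp fL u2L).
  apply: lin_add; first exact: lin_comp fL TL.
  exact: lin_comp s1L (lin_comp fL uSuL).
have t_x w : t (x w) = f (T (x w)) + s1 (f (u (S (u (x w))))).
  by rewrite /t u2x (lin0 fL) (lin0 s2L) addr0.
have t_xx w : t (x (x w)) = f (T (x (x w))).
  by rewrite t_x !ux xxu (lin0 SL) (lin0 uL) (lin0 fL) (lin0 s1L) addr0.
rewrite t_xx t_x /t !(linD yL) !fu fu2 -!fx.
have -> : f v = f (e v + (e2 v + u2 v))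
  by rewrite [e2 v + _]addrC (subrK (e2 v) (u v)) addrC (subrK (e v) v).
rewrite /e /e2; move: (u2 v) (u (S (u v))) (u (S (u (x v)))) => w d h.
by rewrite !(linD fL) !addrA [LHS](ACl (1 * 4 * 6 * 2 * 5 * 3)).
Qed.

End NilpotentOperators.

(** * Ghosts over cyclic groups of order 2 and 3 *)

Section CyclicGroups.

Set Implicit Arguments.
Unset Strict Implicit.
Unset Printing Implicit Defensive.
Import GRing.Theory.
Local Open Scope ring_scope.

Variables (k : fieldType) (gT : finGroupType) (G : {group gT}) (g : gT).
Hypothesis Gg : G :=: <[g]>%g.
Implicit Types L M N : kGmod k G.

Local Notation "x |> v" := (Defs.act x v) (at level 38, right associativity).

Let gG : g \in G. Proof. by rewrite Gg cycle_id. Qed.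

Lemma cyclic_equivariant M N (f : carrier M -> carrier N) :
  (forall v, f (g |> v) = g |> f v) -> equivariant G f.
Proof.
move=> fg x; rewrite Gg => /cycleP[n ->]; elim: n => [|n IHn] v.
  by rewrite expg0 !act_one.
by rewrite expgS !act_mul ?groupX // fg IHn.
Qed.

Lemma sum_cycle (V : nmodType) (F : gT -> V) :
  \sum_(y in G) F y = \sum_(i < #[g]%g) F (g ^+ i)%g.
Proof.
have inj : {in [set: 'I_#[g]%g] &, injective (fun i : 'I_#[g]%g => g ^+ i)%g}.
  move=> i j _ _ /eqP; rewrite eq_expg_mod_order !modn_small //.
  by move/eqP/val_inj.
transitivity (\sum_(i in [set: 'I_#[g]%g]) F (g ^+ i)%g); last first.
  by apply: eq_bigl => i; rewrite inE.
rewrite -(big_imset F inj) /=; apply: eq_bigl => y; rewrite Gg.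
apply/idP/imsetP => [/cyclePmin[i ig ->]|[i _ ->]]; last exact: mem_cycle.
by exists (Ordinal ig); rewrite ?inE.
Qed.

Local Notation D v := (g |> v - v).

Lemma D_lin M : lin (fun v : carrier M => g |> v - v).
Proof. exact: shift_lin gG M. Qed.

(** Composing with [g ^ (p - 1)] turns the trace into the sum of the [g ^ i t g ^ (p - 1 - i)]. In
    characteristic [p], the polynomial [(X ^ p - Y ^ p) / (X - Y)] equals [(X - Y) ^ (p - 1)], so
    replacing [g] by [g - 1] on both sides does not change this sum. *)
Lemma trace_order2 M N (t : carrier M -> carrier N) v : #[g]%g = 2%N -> 2%:R = 0 :> k ->
  lin t -> trace G (fun v => t (g |> v)) v = D (t v) + t (D v).
Proof.
move=> og k2 tL; have N2 (w : carrier N) : w + w = 0.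
  by rewrite -mulr2n -scaler_nat k2 scale0r.
rewrite /trace sum_cycle og !big_ord_recl big_ord0 /= addr0 expg0 expg1 invg1.
rewrite !act_one actKV // (linB tL) addrACA -opprD N2 oppr0 addr0.
by rewrite addrC.
Qed.

Lemma trace_order3 M N (t : carrier M -> carrier N) v : #[g]%g = 3%N -> 3%:R = 0 :> k ->
  lin t -> trace G (fun v => t (g |> g |> v)) v = D (D (t v)) + D (t (D v)) + t (D (D v)).
Proof.
move=> og k3 tL; have N3 (w : carrier N) : w + w + w = 0.
  by have := scaler_nat 3%N w; rewrite k3 scale0r !mulrS mulr0n addr0 addrA.
rewrite /trace sum_cycle og !big_ord_recl big_ord0 /= addr0 expg0 expg1 invg1.
have g2E w : (g ^+ 2)%g |> w = g |> g |> w :> carrier N by rewrite -act_mul.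
have g2K w : g |> g |> (g ^+ 2)^-1%g |> w = w :> carrier M.
  by rewrite -act_mul // actKV ?groupM.
rewrite !act_one actKV // g2K g2E.
rewrite !(linB tL) !(linB (act_lin _ gG)) !(linB tL).
move: (t (g |> g |> v)) (g |> t (g |> v)) (g |> g |> t v) => a b c.
move: (g |> t v) (t (g |> v)) (t v) => d h e.
rewrite !opprB !addrA [RHS](ACl (9*5*1*(3*7*11)*(2*4*6)*(8*10*12))) /=.
by rewrite -!opprD !N3 !oppr0 !addr0.
Qed.

Lemma D2_0 M (m : carrier M) : #[g]%g = 2%N -> 2%:R = 0 :> k -> D (D m) = 0.
Proof.
move=> og k2; rewrite (linB (act_lin M gG)).
have -> : g |> g |> m = (g ^+ 2)%g |> m by rewrite -act_mul.
rewrite -og expg_order act_one.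
by rewrite -[m - _]opprB -opprD -mulr2n -scaler_nat k2 scale0r oppr0.
Qed.

Lemma act_order3 M (m : carrier M) : #[g]%g = 3%N -> g |> g |> g |> m = m.
Proof.
move=> og; have -> : g |> g |> g |> m = (g ^+ 3)%g |> m.
  by rewrite !expgS expg0 mulg1 !act_mul ?groupM.
by rewrite -og expg_order act_one.
Qed.

Lemma D3_0 M (m : carrier M) : #[g]%g = 3%N -> 3%:R = 0 :> k -> D (D (D m)) = 0.
Proof.
move=> og k3; have gL := act_lin M gG; rewrite !(linB gL).
rewrite act_order3 //.
have N3 (w : carrier M) : w + w + w = 0.
  by have := scaler_nat 3%N w; rewrite k3 scale0r !mulrS mulr0n addr0 addrA.
(* Once [g ^ 3 = 1], the cube of [g - 1] is [3 (g - g ^ 2)]. *)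
rewrite -[RHS](N3 (g |> m - g |> g |> m)).
move: (g |> g |> m) (g |> m) => c d; rewrite !opprB !addrA.
by rewrite [LHS](ACl (3*2*5*4*7*8*(1*6))) /= subrr addr0.
Qed.

(** A fixed vector is a homomorphism from [k], the zeroth syzygy, so the ghost condition applies to
    it. *)
Lemma ghost_fixed M N (f : carrier M -> carrier N) (m : carrier M) :
  ghost f -> D m = 0 ->
  exists2 t : carrier (trivial_mod k G) -> carrier N, lin t & f m = trace G t 1.
Proof.
move=> gf /eqP; rewrite subr_eq0 => /eqP gm.
have triv : Omega 0 (trivial_mod k G) by exists id, id; split.
pose h (c : carrier (trivial_mod k G)) : carrier M := c *: m.
have hh : is_hom h.
  split=> [a u v|]; first by rewrite /h scalerDl scalerA.
  by apply: cyclic_equivariant => v; rewrite /h (linZ (act_lin M gG)) gm.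
have /stably_trivial_trace[t tL tE] := gf _ _ triv h hh.
by exists t => //; rewrite -tE /h scale1r.
Qed.

Lemma ghost_stably_trivial_order2 M N (f : carrier M -> carrier N) :
  #[g]%g = 2%N -> 2%:R = 0 :> k -> is_hom f -> ghost f -> stably_trivial f.
Proof.
move=> og k2 fh gf; have fL := hom_lin fh.
have fD m : f (D m) = D (f m) by rewrite linB // (hom_equivariant fh).
have [m|m Dm0|t tL tE] := square_zero_decomposition (@D_lin M) (@D_lin N) fL fD.
- exact: D2_0.
- have [t tL ->] := ghost_fixed gf Dm0.
  have D1 : D (1 : carrier (trivial_mod k G)) = 0 by apply: subrr.
  rewrite (trace_order2 (1 : carrier (trivial_mod k G)) og k2 tL) D1 (lin0 tL) addr0.
  by exists (t 1).
apply/stably_trivial_trace; exists (fun v => t (g |> v)) => [|v].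
  exact: lin_comp tL (act_lin M gG).
by rewrite trace_order2.
Qed.

(** * Order 3: the first syzygy of [k], and a projective module mapping onto [k] *)

Section Order3.

Variable lam : gT -> k.
Hypotheses (og : #[g]%g = 3%N) (k3 : 3%:R = 0 :> k) (lamg : lam g = 1).
Hypothesis lamM : {in G &, forall a b, lam (a * b)%g = lam a + lam b}.

Fact shear_act_linear x : x \in G -> forall (a : k) u v,
  shear lam x (a *: u + v) = a *: shear lam x u + shear lam x v.
Proof. by move=> _; apply: shear_lin. Qed.

Fact shear_actM x y : x \in G -> y \in G -> forall v,
  shear lam (x * y)%g v = shear lam x (shear lam y v).
Proof. by move=> xG yG v; apply: (shearM lamM). Qed.

Definition shear_mod : kGmod k G := KGmod shear_act_linear (shear1 lamM) shear_actM.

Definition space : lmodType k := (k^o * k^o * k^o)%type.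

(* In characteristic 3 this is exp (lam a X), where X is a nilpotent Jordan
   block of size 3, since 1 / 2 = -1. *)
Definition exp_act (a : gT) (w : space) : space :=
  (w.1.1 + lam a * w.1.2 - lam a ^+ 2 * w.2, w.1.2 + lam a * w.2, w.2).

Fact exp_act_linear x : x \in G -> forall (a : k) u v,
  exp_act x (a *: u + v) = a *: exp_act x u + exp_act x v.
Proof.
have E1 (a l u1 u2 u3 v1 v2 v3 : k) :
    a * u1 + v1 + l * (a * u2 + v2) - l ^+ 2 * (a * u3 + v3) =
    a * (u1 + l * u2 - l ^+ 2 * u3) + (v1 + l * v2 - l ^+ 2 * v3) by ring.
have E2 (a l u2 u3 v2 v3 : k) :
    a * u2 + v2 + l * (a * u3 + v3) = a * (u2 + l * u3) + (v2 + l * v3) by ring.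
by move=> _ a u v; congr (_, _, _); [apply: E1 | apply: E2].
Qed.

Fact exp_act1 w : exp_act 1%g w = w.
Proof.
rewrite /exp_act (lam1 lamM) expr0n !mul0r subr0 !addr0.
by case: w => [[]].
Qed.

Fact exp_actM x y : x \in G -> y \in G -> forall w,
  exp_act (x * y)%g w = exp_act x (exp_act y w).
Proof.
have E1 (l m u1 u2 u3 : k) : u1 + (l + m) * u2 - (l + m) ^+ 2 * u3 =
    u1 + m * u2 - m ^+ 2 * u3 + l * (u2 + m * u3) - l ^+ 2 * u3.
  (* The cross terms [-2 l m u3] on the left and [l m u3] on the right agree modulo 3. *)
  by rewrite -[LHS]addr0 -(mul0r (l * m * u3)) -k3; ring.
have E2 (l m u2 u3 : k) : u2 + (l + m) * u3 = u2 + m * u3 + l * u3 by ring.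
by move=> xG yG w; rewrite /exp_act lamM //; congr (_, _, _); [apply: E1 | apply: E2].
Qed.

Definition exp_mod : kGmod k G := KGmod exp_act_linear exp_act1 exp_actM.

Lemma exp_mod_projective : projective exp_mod.
Proof.
(* With [X] the nilpotent Jordan block, sending the first coordinate to the third has trace
   [1 - X ^ 2]; the extra [w.2] contributes the missing [X ^ 2]. *)
pose t (w : space) : space := (0, 0, w.1.1 + w.2).
have tL : lin t.
  have E0 (a : k) : 0 = a * 0 + 0 by ring.
  have E (a u v u' v' : k) : a * u + v + (a * u' + v') = a * (u + u') + (v + v') by ring.
  by move=> a u v; congr (_, _, _); [apply: E0 | apply: E0 | apply: E].
apply: (@trace_projective _ _ _ exp_mod t tL) => w.
pose s l : k := w.1.1 - l * w.1.2 - l ^+ 2 * w.2 + w.2.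
have summand a : a \in G ->
    exp_act a (t (exp_act a^-1%g w)) = (- lam a ^+ 2 * s (lam a), lam a * s (lam a), s (lam a)).
  have E1 (l x y z : k) : 0 + l * 0 - l ^+ 2 * (x + - l * y - (- l) ^+ 2 * z + z) =
    - l ^+ 2 * (x - l * y - l ^+ 2 * z + z) by ring.
  have E2 (l x y z : k) : 0 + l * (x + - l * y - (- l) ^+ 2 * z + z) =
    l * (x - l * y - l ^+ 2 * z + z) by ring.
  have E3 (l x y z : k) : x + - l * y - (- l) ^+ 2 * z + z =
    x - l * y - l ^+ 2 * z + z by ring.
  move=> aG; rewrite /exp_act (lamV lamM) //.
  by congr (_, _, _); [apply: E1 | apply: E2 | apply: E3].
rewrite /trace (eq_bigr _ summand) sum_cycle og !big_ord_recl big_ord0 addr0.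
rewrite /bump /= expg0 expg1 (lam1 lamM) lamM // lamg /s.
(* Each coordinate of the sum differs from that of [w] by an explicit multiple of 3. *)
have E1 (x y z : k) : - 0 ^+ 2 * (x - 0 * y - 0 ^+ 2 * z + z) +
    (- 1 ^+ 2 * (x - 1 * y - 1 ^+ 2 * z + z) +
     - (1 + 1) ^+ 2 * (x - (1 + 1) * y - (1 + 1) ^+ 2 * z + z)) = x.
  by transitivity (x + 3%:R * (- x *+ 2 + y *+ 3 + z *+ 4)); [ring | rewrite k3 mul0r addr0].
have E2 (x y z : k) : 0 * (x - 0 * y - 0 ^+ 2 * z + z) +
    (1 * (x - 1 * y - 1 ^+ 2 * z + z) +
     (1 + 1) * (x - (1 + 1) * y - (1 + 1) ^+ 2 * z + z)) = y.
  by transitivity (y + 3%:R * (x - y *+ 2 - z *+ 2)); [ring | rewrite k3 mul0r addr0].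
have E3 (x y z : k) : (x - 0 * y - 0 ^+ 2 * z + z) +
    ((x - 1 * y - 1 ^+ 2 * z + z) +
     (x - (1 + 1) * y - (1 + 1) ^+ 2 * z + z)) = z.
  by transitivity (z + 3%:R * (x - y - z)); [ring | rewrite k3 mul0r addr0].
case: w {s summand} => [[x y] z] /=.
by congr (_, _, _); [apply: E1 | apply: E2 | apply: E3].
Qed.

(** The plane is the kernel of the last coordinate of [exp_mod], on which [G] acts trivially. *)
Lemma Omega1_shear_mod : Omega 1 shear_mod.
Proof.
exists (trivial_mod k G), exp_mod.
exists (fun w : plane k => (w.1, w.2, 0) : space), (fun w : space => w.2).
split.
- exact: exp_mod_projective.
- by exists id, id; split.
split.
- split=> [a u v|x xG v]; first by congr (_, _, _); rewrite /= ?scaler0 ?addr0.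
  by congr (_, _, _); rewrite /= ?mulr0 ?subr0 ?addr0.
- by split.
- by move=> [u1 u2] [v1 v2] [-> ->].
- by move=> c; exists (0, 0, c).
move=> [[x y] z]; split=> [/= ->|[[u v] [_ _ <-]]//].
by exists (x, y).
Qed.

Lemma ghost_stably_trivial_order3 M N (f : carrier M -> carrier N) :
  is_hom f -> ghost f -> stably_trivial f.
Proof.
move=> fh gf; have fL := hom_lin fh; have gL := act_lin M gG.
have fD m : f (D m) = D (f m) by rewrite linB // (hom_equivariant fh).
have D3 L m := @D3_0 L m og k3.
have [|m Dm0|m DDm0|t tL tE] :=
    cube_zero_decomposition (@D_lin M) (@D_lin N) fL fD; first exact: D3.
- have [t tL ->] := ghost_fixed gf Dm0.
  have D1 : D (1 : carrier (trivial_mod k G)) = 0 by apply: subrr.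
  rewrite (trace_order3 (1 : carrier (trivial_mod k G)) og k3 tL) D1 (lin0 tL).
  rewrite !(lin0 (act_lin _ gG)) !subrr (lin0 tL) !addr0.
  by exists (t 1).
(* A vector [m] killed by [(g - 1) ^ 2] is the image of the second basis vector under a homomorphism
   from the first syzygy. *)
- pose h (w : plane k) : carrier M := w.1 *: (D m) + w.2 *: m.
  have hh : @is_hom _ _ _ shear_mod M h.
    split=> [a u v|].
      have E (u1 u2 v1 v2 : k) : (a * u1 + v1) *: D m + (a * u2 + v2) *: m =
          a *: (u1 *: D m + u2 *: m) + (v1 *: D m + v2 *: m).
        by rewrite !scalerDl [in RHS]scalerDr !scalerA addrACA.
      exact: E.
    apply: cyclic_equivariant => w.
    have gDm : g |> D m = D m by apply/eqP; rewrite -subr_eq0 DDm0.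
    have -> : h (g |> w) = (w.1 + w.2) *: D m + w.2 *: m.
      by rewrite /h /= /shear lamg mul1r.
    rewrite /h (linD gL) !(linZ gL) gDm scalerDl -addrA.
    by congr (_ + _); rewrite -scalerDr subrK.
  have /stably_trivial_trace[t tL tE] := gf _ _ Omega1_shear_mod h hh.
  pose e2 : carrier shear_mod := (0, 1).
  (* As [g ^ 3 = 1], this gives [t = t' g ^ 2], the form needed for [trace_order3]. *)
  pose t' (w : carrier shear_mod) := t (g |> w).
  have t'L : lin t' by apply: lin_comp tL (act_lin shear_mod gG).
  have t'E w : t w = t' (g |> g |> w).
    by rewrite /t' act_order3.
  exists (D (t' e2) + t' (D e2)).
  have -> : f m = f (h e2) by rewrite /h scale0r scale1r add0r.
  rewrite tE (eq_trace _ _ t'E) (trace_order3 e2 og k3 t'L).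
  have DE (w : carrier shear_mod) : D w = nilp w by apply: shear_nilp.
  rewrite !DE (_ : nilp (nilp _) = 0) // (lin0 t'L) addr0.
  exact: esym (linD (@D_lin N) _ _).
apply/stably_trivial_trace; exists (fun v => t (g |> g |> v)) => [|v].
  exact: lin_comp tL (lin_comp (act_lin M gG) (act_lin M gG)).
by rewrite trace_order3.
Qed.

End Order3.

End CyclicGroups.

Theorem theorem1p1 (p : nat) (gT : finGroupType) (G : {group gT}) (k : fieldType) :
  prime p -> p.-group G -> G :!=: 1 -> p \in [pchar k]%R ->
  ((forall (M N : kGmod k G) (f : carrier M -> carrier N),
       is_hom f -> ghost f -> stably_trivial f)
   <-> (G \isog Zp 2 \/ G \isog Zp 3)).
Proof.
move=> p_pr pG G1 charkp; split=> [noghost|isoG].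
  have [//|nG] := boolp.pselect (G \isog Zp 2 \/ G \isog Zp 3).
  have [A [AG abA A1 largeA]] := abelian_subgroup_exists p_pr pG G1 nG.
  have pA := pgroupS AG pG.
  have [c [lam [cA c1 lamM S1 S2]]] := balanced_additive_character p_pr pA charkp A1 largeA.
  have cC : c \in 'C(A) by apply: (subsetP abA).
  case: (coind_nilp_nontrivial AG lamM (pgroup_card0 charkp pA A1) S1 S2).
  apply: noghost; first exact: coind_nilp_hom.
  exact: (coind_nilp_ghost AG lamM cA cC c1).
(* A character of [G] itself: [lam c = 1] forces [c] to be non-trivial, hence a generator when [G]
   has prime order, and [lam] defines the modules of the order 3 case. *)
have [K [c [lam [_ _ cG c1 [lamM _]]]]] := additive_character p_pr pG charkp G1.
have cardGp n : prime n -> #|G| = n -> p = n.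
  move=> n_pr cardG; apply/eqP; rewrite -(dvdn_prime2 p_pr n_pr) -cardG.
  by have [_ ->] := pgroup_pdiv pG G1.
have cyc n : prime n -> #|G| = n -> G :=: <[c]> /\ #[c] = n.
  move=> n_pr cardG; have oc : #[c] = n.
    apply/(prime_nt_dvdP n_pr); last by rewrite -cardG order_dvdG.
    rewrite order_eq1; apply/eqP => c0; have := lam1 lamM.
    by rewrite -c0 c1 => /eqP; rewrite GRing.oner_eq0.
  split=> //; apply/esym/eqP; rewrite eqEcard cycle_subG cG cardG.
  by rewrite -[#|<[c]>|]/#[c] oc leqnn.
move=> M N f fh gf; case: isoG => /card_isog; rewrite card_Zp // => cardG.
  have [Gc oc] := cyc 2 isT cardG.
  apply: (ghost_stably_trivial_order2 Gc oc) => //.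
  by rewrite -(cardGp 2 isT cardG) (GRing.pcharf0 charkp).
have [Gc oc] := cyc 3 isT cardG.
apply: (ghost_stably_trivial_order3 Gc oc _ c1 lamM) => //.
by rewrite -(cardGp 3 isT cardG) (GRing.pcharf0 charkp).
Qed.
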